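(* Let $\bm{\hat u}^*=(\bm{\hat u}_1^*,\dots,\bm{\hat u}_{N_x}^* )$ be a fixed point of the classical IPM iteration, and assume that this iteration is contractive at $\bm{\hat u}^*$, i.e. the Jacobian at $\bm{\hat u}^*$ of the map $(\bm{\hat u}_j)_{j=1}^{N_x}\mapsto\big(\bm{\tilde c}(\bm{\hat u}_{j-1},\bm{\hat u}_j,\bm{\hat u}_{j+1})\big)_{j=1}^{N_x}$ has spectral radius strictly less than $1$. Let $\bm{\lambda}^*=(\bm{\lambda}^*_j)_{j=1}^{N_x}$ with $\bm{\lambda}_j^*=\bm{\hat\lambda}(\bm{\hat u}_j^* )$. Then the Jacobian $\bm J$ of the One-Shot IPM iteration, i.e. of the map $\Phi:(\bm\lambda,\bm{\hat u})\mapsto(\bm\lambda',\bm{\hat u}')$ defined in the context, has spectral radius $\rho(\bm J)<1$ at the fixed point $(\bm{\lambda}^*,\bm{\hat u}^* )$.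
   Context: Setting (Intrusive Polynomial Moment (IPM) method for a steady hyperbolic problem, iterated in pseudo-time, one space dimension). Let $m,p,M,N_x,Q$ be natural numbers. Let $\bm f:\mathbb{R}^m\to\mathbb{R}^m$ be the physical flux and $\bm g:\mathbb{R}^m\times\mathbb{R}^m\to\mathbb{R}^m$ a consistent numerical flux ($\bm g(\bm u,\bm u)=\bm f(\bm u)$). Let $\bm\xi\in\Theta\subseteq\mathbb{R}^p$ be a random vector with density $f_\Xi$ (a product of one-dimensional densities), let $\varphi_i:\Theta\to\mathbb{R}$, $|i|\le M$ ($i=(i_1,\dots,i_p)$ a multi-index, $|i|=\sum_n i_n$), be polynomials orthonormal with respect to $f_\Xi$, and put $N=\binom{M+p}{p}$, $\bm\varphi=(\varphi_i)_{|i|\le M}\in\mathbb{R}^N$. Given quadrature weights $w_k$ and points $\bm\xi_k$, $k=1,\dots,Q$, write $\langle h\rangle_Q:=\sum_{k=1}^Q w_k h(\bm\xi_k)f_\Xi(\bm\xi_k)$. Let $s:\mathbb{R}^m\to\mathbb{R}$ be a strictly convex entropy, $s_*$ its Legendre transform and $\bm u_s:=(\nabla_{\bm u}s)^{-1}=\nabla s_*$. For a moment matrix $\bm{\hat u}=(\bm{\hat u}_i)_{|i|\le M}\in\mathbb{R}^{N\times m}$ and $\bm\lambda=(\bm\lambda_i)_{|i|\le M}\in\mathbb{R}^{N\times m}$ let $$L(\bm\lambda;\bm{\hat u}):=\langle s_*(\bm\lambda^T\bm\varphi)\rangle_Q-\sum_{|i|\le M}\bm\lambda_i^T\bm{\hat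 u}_i .$$ Its gradient is $\nabla_{\bm\lambda}L(\bm\lambda;\bm{\hat u})=\langle\bm u_s(\bm\lambda^T\bm\varphi)\bm\varphi^T\rangle_Q^T-\bm{\hat u}$, and its Hessian in $\bm\lambda$ (with $\mathbb{R}^{N\times m}$ identified with $\mathbb{R}^{N\cdot m}$) is denoted $\bm H(\bm\lambda)=\langle\nabla\bm u_s(\bm\lambda^T\bm\varphi)\otimes\bm\varphi\bm\varphi^T\rangle_Q^T$. The exact dual variables $\bm{\hat\lambda}(\bm{\hat u})$ are the unique minimizer of $L(\cdot\,;\bm{\hat u})$, so that $\langle\bm u_s(\bm{\hat\lambda}(\bm{\hat u})^T\bm\varphi)\bm\varphi^T\rangle_Q^T=\bm{\hat u}$. The dual (Newton) iteration function is $$\bm d(\bm\lambda,\bm{\hat u}):=\bm\lambda-\bm H(\bm\lambda)^{-1}\cdot\nabla_{\bm\lambda}L(\bm\lambda;\bm{\hat u}).$$ For $\Delta t,\Delta x>0$ define $$\bm c(\bm\lambda_\ell,\bm\lambda_c,\bm\lambda_r):=\langle\bm u_s(\bm\lambda_c^T\bm\varphi)\bm\varphi^T\rangle_Q^T-\frac{\Delta t}{\Delta x}\Big(\langle\bm g(\bm u_s(\bm\lambda_c^T\bm\varphi),\bm u_s(\bm\lambda_r^T\bm\varphi))\bm\varphi^T\rangle_Q^T-\langle\bm g(\bm u_s(\bm\lambda_\ell^T\bm\varphi),\bm u_s(\bm\lambda_c^T\bm\varphi))\bm\varphi^T\rangle_Q^T\Big)$$ and $\bm{\tilde c}(\bm{\hat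 u}_\ell,\bm{\hat u}_c,\bm{\hat u}_r):=\bm c(\bm{\hat\lambda}(\bm{\hat u}_\ell),\bm{\hat\lambda}(\bm{\hat u}_c),\bm{\hat\lambda}(\bm{\hat u}_r))$. Spatial cells are $j=1,\dots,N_x$; the boundary (ghost) cells $j=0$ and $j=N_x+1$ carry prescribed values $\bm{\hat u}_0,\bm{\hat u}_{N_x+1}$ and $\bm\lambda_0=\bm{\hat\lambda}(\bm{\hat u}_0)$, $\bm\lambda_{N_x+1}=\bm{\hat\lambda}(\bm{\hat u}_{N_x+1})$ which do not change during the iterations. Classical IPM iteration: $\bm{\hat u}_j^{n+1}=\bm{\tilde c}(\bm{\hat u}_{j-1}^n,\bm{\hat u}_j^n,\bm{\hat u}_{j+1}^n)$ for $j=1,\dots,N_x$. One-Shot IPM iteration: for $j=1,\dots,N_x$, $\bm\lambda_j^{n+1}=\bm d(\bm\lambda_j^n,\bm{\hat u}_j^n)$, followed by $\bm{\hat u}_j^{n+1}=\bm c(\bm\lambda_{j-1}^{n+1},\bm\lambda_j^{n+1},\bm\lambda_{j+1}^{n+1})$. Written as a fixed-point iteration, $(\bm\lambda^{n+1},\bm{\hat u}^{n+1})=\Phi(\bm\lambda^n,\bm{\hat u}^n)$, where $\Phi(\bm\lambda,\bm{\hat u})=(\bm\lambda',\bm{\hat u}')$ with $\bm\lambda'_j=\bm d(\bm\lambda_j,\bm{\hat u}_j)$, and $\bm{\hat u}'_j=\bm c(\bm\lambda'_{j-1},\bm\lambda'_j,\bm\lambda'_{j+1})$ for $j=1,\dots,N_x$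 (with $\bm\lambda'_0=\bm\lambda_0$, $\bm\lambda'_{N_x+1}=\bm\lambda_{N_x+1}$), acting on $\mathbb{R}^{N\cdot m\cdot N_x}\times\mathbb{R}^{N\cdot m\cdot N_x}$. Standing regularity: $\bm u_s$ and $\bm g$ are smooth enough that the derivatives involved exist and are continuous near the fixed point, $\bm H(\bm\lambda)$ is invertible, and $\bm{\hat\lambda}(\cdot)$ is well defined where used. *)

(* Defs.v *)
From HB Require Import structures.
From mathcomp Require Import all_boot all_order all_algebra.
From mathcomp Require Import all_classical all_reals all_analysis.
From mathcomp Require mpoly.
From mathcomp Require Import complex.
Set Implicit Arguments.
Unset Strict Implicit.
Unset Printing Implicit Defensive.
Import Order.TTheory GRing.Theory Num.Theory numFieldNormedType.Exports.
Local Open Scope classical_set_scope.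
Local Open Scope ring_scope.

Definition grad (R : realType) (a b : nat) (h : 'M[R]_(a, b) -> R)
    (x : 'M[R]_(a, b)) : 'M[R]_(a, b) :=
  \matrix_(i, j) 'D_(delta_mx i j) h x.

(* Second derivative of h, with matrices identified with vectors by mxvec.
   Like the library's 'J, the matrix acts on row vectors from the right. *)
Definition hess (R : realType) (a b : nat) (h : 'M[R]_(a, b) -> R)
    (x : 'M[R]_(a, b)) : 'M[R]_(a * b) :=
  jacobian (fun v : 'rV[R]_(a * b) => mxvec (grad h (vec_mx v))) (mxvec x).

Definition C1_near (R : realType) (V W : normedModType R) (h : V -> W) (x : V) :
    Prop :=
  \forall y \near x, differentiable h y /\
    forall v : V, {for y, continuous (fun z => 'd h z v)}.

Definition strictly_convex (R : realType) (a : nat) (h : 'cV[R]_a -> R) : Prop :=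
  forall (x y : 'cV[R]_a) (t : R), x <> y -> 0 < t -> t < 1 ->
    h (t *: x + (1 - t) *: y) < t * h x + (1 - t) * h y.

Definition dotmx (R : realType) (a b : nat) (x y : 'M[R]_(a, b)) : R :=
  \sum_(i < a) \sum_(j < b) x i j * y i j.

Definition legendre (R : realType) (a : nat) (h : 'cV[R]_a -> R)
    (v : 'cV[R]_a) : R :=
  sup [set dotmx v u - h u | u in [set: 'cV[R]_a]].

(* Largest modulus of a complex eigenvalue of a real matrix; it is 0 for the
   empty matrix, which has no eigenvalue. *)
Definition spectral_radius (R : realType) (n : nat) (A : 'M[R]_n) : R :=
  sup [set ComplexField.Normc.normc z | z in
        [set z : R[i] | eigenvalue (map_mx (real_complex R) A) z]].

(* X is a random vector with density x |-> \prod_n f1 n (x_n) on R^p.  The law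
   is prescribed on measurable boxes, which determine it. *)
Definition has_product_density (R : realType) (p : nat) (d : measure_display)
    (T : measurableType d) (P : probability T R) (X : T -> 'cV[R]_p)
    (f1 : 'I_p -> R -> R) : Prop :=
  [/\ forall n, measurable_fun [set: T] (fun t => X t n 0),
      forall n, measurable_fun [set: R] (f1 n),
      forall n x, 0 <= f1 n x,
      forall n, (\int[lebesgue_measure]_x (f1 n x)%:E = 1)%E
    & forall A : 'I_p -> set R, (forall n, measurable (A n)) ->
        P [set t | forall n, A n (X t n 0)] =
        (\prod_(n < p) \int[lebesgue_measure]_(x in A n) (f1 n x)%:E)%E].

(* Multi-indices i in N^p with |i| <= M.  mpoly is not imported because its
   notations clash with those of the analysis library. *)
Notation mindex p M := (mpoly.bmultinom p M.+1).

Definition mpeval (R : realType) (p : nat) (q : mpoly.mpoly p R)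
    (x : 'cV[R]_p) : R :=
  mpoly.meval (fun n => x n 0) q.

(* Orthonormality for the density of X, i.e. in L^2 of its law; asbool stands for
   the boolean equality, whose instance on multi-indices is not imported. *)
Definition orthonormal_wrt (R : realType) (p M : nat) (d : measure_display)
    (T : measurableType d) (P : probability T R) (X : T -> 'cV[R]_p)
    (phi : mindex p M -> mpoly.mpoly p R) : Prop :=
  forall i j : mindex p M,
    (\int[P]_t (mpeval (phi i) (X t) * mpeval (phi j) (X t))%:E =
     ((`[< i = j >])%:R : R)%:E)%E.

(* The data of the discretization; a moment matrix is a matrix in
   'M[R]_('C(M + p, p), m), whose rows follow the enumeration of the
   multi-indices given by ipm_index. *)
Record ipm (R : realType) (m p M Q : nat) : Type := Ipm {
  ipm_entropy : 'cV[R]_m -> R;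
  ipm_numflux : 'cV[R]_m -> 'cV[R]_m -> 'cV[R]_m;
  ipm_density1 : 'I_p -> R -> R;
  ipm_poly : mindex p M -> mpoly.mpoly p R;
  ipm_index : 'I_'C(M + p, p) -> mindex p M;
  ipm_weight : 'I_Q -> R;
  ipm_node : 'I_Q -> 'cV[R]_p;
  ipm_dt : R;
  ipm_dx : R }.

Section IPM.
Variables (R : realType) (m p M Q : nat) (D : ipm R m p M Q).
Local Notation N := 'C(M + p, p).
Local Notation moments := 'M[R]_(N, m).

Definition density (x : 'cV[R]_p) : R := \prod_(n < p) ipm_density1 D n (x n 0).

Definition basis (x : 'cV[R]_p) : 'cV[R]_N :=
  \col_k mpeval (ipm_poly D (ipm_index D k)) x.

Definition quad (V : lmodType R) (h : 'cV[R]_p -> V) : V :=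
  \sum_(k < Q) (ipm_weight D k * density (ipm_node D k)) *: h (ipm_node D k).

(* The inverse (grad s)^-1, meaningful when grad s is bijective. *)
Definition us : 'cV[R]_m -> 'cV[R]_m :=
  'pinv_(fun=> 0) [set: 'cV[R]_m] (grad (ipm_entropy D)).

Definition dual_state (lam : moments) (x : 'cV[R]_p) : 'cV[R]_m :=
  lam^T *m basis x.

Definition dual_obj (lam u : moments) : R :=
  quad (fun x => legendre (ipm_entropy D) (dual_state lam x) : R^o)
  - dotmx lam u.

Definition dual_minimizer (u lam : moments) : Prop :=
  forall lam' : moments, dual_obj lam u <= dual_obj lam' u.

Definition hatlam (u : moments) : moments :=
  xget 0 [set lam | dual_minimizer u lam].

Definition dual_grad (lam u : moments) : moments :=
  grad (fun l => dual_obj l u) lam.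

(* This does not depend on u, in which dual_obj is affine. *)
Definition dual_hess (lam u : moments) : 'M[R]_(N * m) :=
  hess (fun l => dual_obj l u) lam.

(* The correction solves (correction) *m Hessian = gradient, since dual_hess acts
   on row vectors from the right. *)
Definition newton (lam u : moments) : moments :=
  lam - vec_mx (mxvec (dual_grad lam u) *m invmx (dual_hess lam u)).

Definition cstep (ll lc lr : moments) : moments :=
  let flux l1 l2 : moments :=
    (quad (fun x => ipm_numflux D (us (dual_state l1 x)) (us (dual_state l2 x))
                    *m (basis x)^T))^T in
  (quad (fun x => us (dual_state lc x) *m (basis x)^T))^T
  - (ipm_dt D / ipm_dx D) *: (flux lc lr - flux ll lc).

Definition cstep_exact (ul uc ur : moments) : moments :=
  cstep (hatlam ul) (hatlam uc) (hatlam ur).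

Section Cells.
Variable Nx : nat.

(* The values on all cells 0, ..., Nx + 1, from those on the interior cells and
   the ghost values a (cell 0) and b (cell Nx + 1).  Interior cells are numbered
   from 0 in 'I_Nx, so j : 'I_Nx is the cell j.+1. *)
Definition with_ghosts (a b : moments) (v : 'I_Nx -> moments) (j : nat) :
    moments :=
  if j is i.+1 then (if insub i is Some k then v k else b) else a.

(* u0 and u1 are the prescribed moments on the two ghost cells. *)
Variables (u0 u1 : moments).

Definition classical_step (u : 'I_Nx -> moments) : 'I_Nx -> moments :=
  let U := with_ghosts u0 u1 u in
  fun j => cstep_exact (U j) (U j.+1) (U j.+2).

Definition oneshot_step (lam u : 'I_Nx -> moments) :
    ('I_Nx -> moments) * ('I_Nx -> moments) :=
  let lam' : 'I_Nx -> moments := fun j => newton (lam j) (u j) in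
  let L := with_ghosts (hatlam u0) (hatlam u1) lam' in
  (lam', fun j : 'I_Nx => cstep (L j) (L j.+1) (L j.+2)).

Definition pack (v : 'I_Nx -> moments) : 'rV[R]_(Nx * (N * m)) :=
  mxvec (\matrix_j mxvec (v j)).

Definition unpack (x : 'rV[R]_(Nx * (N * m))) : 'I_Nx -> moments :=
  fun j => vec_mx (row j (vec_mx x)).

Definition classical_map (x : 'rV[R]_(Nx * (N * m))) : 'rV[R]_(Nx * (N * m)) :=
  pack (classical_step (unpack x)).

Definition pack2 (lam u : 'I_Nx -> moments) :
    'rV[R]_(Nx * (N * m) + Nx * (N * m)) :=
  row_mx (pack lam) (pack u).

Definition oneshot_map (x : 'rV[R]_(Nx * (N * m) + Nx * (N * m))) :
    'rV[R]_(Nx * (N * m) + Nx * (N * m)) :=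
  let y := oneshot_step (unpack (lsubmx x)) (unpack (rsubmx x)) in
  pack2 y.1 y.2.

End Cells.
End IPM.

(* Main.v *)
(** The dual gradient vanishes at the fixed point, so there the Newton map is
    differentiable although the Hessian H is merely continuous, with derivative
    (dlam, du) |-> H^-1 du.  This is also the derivative of hatlam at ustar, the
    right inverse of the primal map lam |-> <us(lam^T phi) phi^T>^T.  Hence, with K
    the derivative of hatlam on all cells and G that of the finite volume update
    as a function of the dual variables (both acting on row vectors),
    J = [[0, 0], [K, K G]], where K G is the Jacobian of the classical iteration:
    its nonzero eigenvalues are eigenvalues of the classical Jacobian.

    The quadrature weights may be negative, so the dual objective need not be
    convex.  Continuity of hatlam at ustar follows instead from the uniqueness
    of the minimizer and from the boundedness of maximizers of l.v - A(l) for v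
    near a point.  Applied to the entropy, the same argument shows that us
    is continuous and the Legendre transform differentiable everywhere. *)
Require Import Defs.
From HB Require Import structures.
From mathcomp Require Import all_boot all_order all_algebra.
From mathcomp Require Import all_classical all_reals all_analysis.
From mathcomp Require mpoly.
From mathcomp Require Import complex ring lra.
Import Order.TTheory GRing.Theory Num.Theory numFieldNormedType.Exports.
Local Open Scope classical_set_scope.
Local Open Scope ring_scope.
Set Implicit Arguments.
Unset Strict Implicit.
Unset Printing Implicit Defensive.

(* all_algebra also exports a dotmx, from spectral. *)
Local Notation dotmx := Defs.dotmx.

(** * Differentials in finite dimension *)

(** The little-o of a differential becomes an epsilon bound, the form in which the estimates below
    produce it. Uniqueness of the differential then identifies ['d f x] with [df]. *)
Lemma is_diff_le (R : realType) (V W : normedModType R) (f : V -> W)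
    (df : {linear V -> W}) (x : V) :
  continuous df ->
  (forall e, 0 < e -> \forall y \near x,
     `|f y - f x - df (y - x)| <= e * `|y - x|) ->
  is_diff x f df.
Proof.
move=> dfc H.
have E : f \o shift x = cst (f x) + df +o_ 0 id.
  apply/eqaddoP => e e0.
  have := H e e0; rewrite (near_shift 0) /= subr0; apply: filterS => y /=.
  by rewrite !fctE /= addrK opprD addrA.
apply: DiffDef; last exact: diff_unique.
by apply/diff_locallyP; rewrite (diff_unique _ E).
Qed.

Lemma is_diff_nearP (R : realType) (V W : normedModType R) (f df : V -> W) (x : V) :
  is_diff x f df -> forall e, 0 < e -> \forall y \near x,
     `|f y - f x - df (y - x)| <= e * `|y - x|.
Proof.
move=> [dfx <-] e e0.
have /eqaddoP/(_ e e0) := diff_locally dfx.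
rewrite [X in _ -> X](near_shift 0) /= subr0; apply: filterS => y /=.
by rewrite !fctE /= addrK opprD addrA.
Qed.

Lemma cvg_sumr (R : realType) (V : normedModType R) (U I : Type)
    (F : set_system U) (FF : Filter F) (r : seq I) (f : I -> U -> V) (a : I -> V) :
  (forall i, f i x @[x --> F] --> a i) ->
  \sum_(i <- r) f i x @[x --> F] --> \sum_(i <- r) a i.
Proof. by move=> fa; apply: (cvg_big add_continuous). Qed.

Lemma linear_mx_continuous (R : realType) (a b : nat) (W : normedModType R)
    (f : {linear 'M[R]_(a, b) -> W}) : continuous f.
Proof.
have -> : (f : _ -> _) = fun M => \sum_i \sum_j M i j *: f (delta_mx i j).
  apply/funext => M; rewrite {1}(matrix_sum_delta M) linear_sum.
  by apply: eq_bigr => i _; rewrite linear_sum; apply: eq_bigr => j _; rewrite linearZ.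
move=> M.
apply: (@cvg_sumr _ _ _ _ (nbhs M)) => i.
apply: (@cvg_sumr _ _ _ _ (nbhs M)) => j.
by apply: cvgZr_tmp; exact: coord_continuous.
Qed.

Lemma is_diff_linear_mx (R : realType) (a b : nat) (W : normedModType R)
    (f : {linear 'M[R]_(a, b) -> W}) x : is_diff x f f.
Proof.
apply: is_diff_le; first exact: linear_mx_continuous.
by move=> e e0; near=> y; rewrite linearB subrr normr0 mulr_ge0// ltW.
Unshelve. all: by end_near. Qed.

Lemma is_diff_continuous (R : realType) (V W : normedModType R) (f df : V -> W) (x : V) :
  is_diff x f df -> f y @[y --> x] --> f x.
Proof. by case=> /differentiable_continuous. Qed.

Lemma is_diff_linear (R : realType) (V W : normedModType R) (f df : V -> W) (x : V) :
  is_diff x f df -> exists2 L : {linear V -> W}, continuous L & df = L.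
Proof. by case=> dfx <-; exists ('d f x) => //; exact: diff_continuous. Qed.

(** Applying [K] to the first-order remainder of [F] at [g u] gives [g v - g u - K (v - u)] up to
    sign, bounded by a small multiple of [|g v - g u|]. Absorbing that multiple shows that
    [|g v - g u|] is itself at most [(k + e) |v - u|]. *)
Lemma is_diff_right_inverse (R : realType) (V W : normedModType R)
   (F dF : V -> W) (g : W -> V) (K : {linear W -> V}) (u : W) :
  (\forall v \near u, F (g v) = v) ->
  g v @[v --> u] --> g u ->
  is_diff (g u) F dF -> continuous K -> cancel dF K -> is_diff u g K.
Proof.
move=> Fg gc dFu Kc dFK; apply: is_diff_le => // e e0.
have [k k0 Kk] := linear_lipschitz Kc.
have H0 := is_diff_nearP dFu.
have Fgu : F (g u) = u by exact: nbhs_singleton Fg.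
(* c is chosen so that k * c = e / (k + e), whence |g v - g u| <= (k + e) |v - u|. *)
pose c := e / (k * (k + e)).
have ke0 : 0 < k + e by rewrite addr_gt0.
have c0 : 0 < c by rewrite divr_gt0// mulr_gt0.
have Hc := gc _ (H0 c c0).
near=> v.
have : `|F (g v) - F (g u) - dF (g v - g u)| <= c * `|g v - g u|.
  by near: v; exact: Hc.
have -> : F (g v) = v by near: v.
rewrite Fgu => H1.
have H2 : `|g v - g u - K (v - u)| <= k * c * `|g v - g u|.
  rewrite -[g v - g u in leLHS]dFK -linearB -mulrA (le_trans (Kk _))//.
  by rewrite ler_pM2l// distrC.
have H3 : `|g v - g u| <= k * `|v - u| + k * c * `|g v - g u|.
  rewrite -[g v - g u in leLHS](subrK (K (v - u))) addrC.
  by rewrite (le_trans (ler_normD _ _))// lerD.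
apply: (le_trans H2).
have kc : k * c = e / (k + e) by rewrite /c invfM mulrCA mulVKf ?gt_eqF.
rewrite kc in H3 *.
have H4 : `|g v - g u| <= (k + e) * `|v - u|.
  have : k / (k + e) * `|g v - g u| <= k * `|v - u|.
    have -> : k / (k + e) = 1 - e / (k + e).
      by apply: (mulIf (lt0r_neq0 ke0)); rewrite mulrBl !divfK ?gt_eqF// mul1r addrK.
    by rewrite mulrBl mul1r lerBlDr.
  by rewrite -mulrA ler_pM2l// ler_pdivrMl.
rewrite mulrAC ler_pdivrMr// -mulrA ler_pM2l//.
by rewrite mulrC.
Unshelve. all: by end_near. Qed.

Lemma le_coord_norm (R : realType) (a b : nat) (A : 'M[R]_(a, b)) i j :
  `|A i j| <= `|A|.
Proof.
rewrite [leRHS]/Num.Def.normr/= mx_normrE.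
exact: (le_bigmax _ (fun ij : 'I_a * 'I_b => `|A ij.1 ij.2|) (i, j)).
Qed.

Lemma norm_mx_le (R : realType) (a b : nat) (A : 'M[R]_(a, b)) (c : R) :
  0 <= c -> (forall i j, `|A i j| <= c) -> `|A| <= c.
Proof.
by move=> c0 H; rewrite [leLHS]/Num.Def.normr/= mx_normrE; apply/bigmax_leP.
Qed.

Lemma norm_mulmx_le (R : realType) (a b c : nat) (A : 'M[R]_(a, b)) (B : 'M[R]_(b, c)) :
  `|A *m B| <= b%:R * `|A| * `|B|.
Proof.
apply: norm_mx_le => [|i j]; first by rewrite !mulr_ge0.
rewrite mxE (le_trans (ler_norm_sum _ _ _))//.
apply: (@le_trans _ _ (\sum_(k < b) `|A| * `|B|)).
  by apply: ler_sum => k _; rewrite normrM ler_pM// le_coord_norm.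
by rewrite sumr_const card_ord -[leLHS]mulr_natl mulrA.
Qed.

(** In the product rule the variation of [Q] is multiplied by [y x = 0], so continuity of [Q] at [x]
    is enough. This is how the Newton correction is differentiated with a merely continuous
    Hessian. *)
Lemma is_diff_mulmx_vanishing (R : realType) (V : normedModType R) (n p : nat)
   (y dy : V -> 'rV[R]_n) (Q : V -> 'M[R]_(n, p)) (x : V) :
  is_diff x y dy -> y x = 0 -> Q z @[z --> x] --> Q x ->
  is_diff x (fun z => y z *m Q z) (fun h => dy h *m Q x).
Proof.
move=> dyx yx0 Qc; have [L Lc dyL] := is_diff_linear dyx; rewrite {}dyL in dyx *.
apply: (@is_diff_le _ _ _ _ (mulmxr (Q x) \o L) x).
  move=> h; apply: continuous_comp; first exact: Lc.
  exact: linear_mx_continuous.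
move=> e e0; have [k k0 Lk] := linear_lipschitz Lc.
(* [q] bounds [n |Q z|] once [|Q x - Q z| < 1]. [c] controls the remainder of [y] and [e'] the
   distance [|Q x - Q z|], so that each contributes at most [e / 2 * |z - x|]. *)
pose q := n%:R * (`|Q x| + 1).
have q0 : 0 <= q by rewrite mulr_ge0// addr_ge0.
pose c := e / 2 / (q + 1).
pose e' := e / 2 / (n%:R * k + 1).
have c0 : 0 < c by rewrite !divr_gt0// ltr_wpDl.
have e'0 : 0 < e' by rewrite !divr_gt0// ltr_wpDl// mulr_ge0// ltW.
have Hd := is_diff_nearP dyx c0.
move/cvgrPdist_lt : Qc => Qc.
near=> z.
have H1 : `|y z - y x - L (z - x)| <= c * `|z - x| by near: z.
have H2 : `|Q x - Q z| < e' by near: z; apply: Qc.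
have H3 : `|Q x - Q z| < 1 by near: z; apply: Qc.
rewrite yx0 mul0mx subr0 /=.
rewrite yx0 subr0 in H1.
have -> : y z *m Q z - L (z - x) *m Q x =
   (y z - L (z - x)) *m Q z - L (z - x) *m (Q x - Q z).
  by rewrite mulmxBl mulmxBr opprB addrA subrK.
rewrite (le_trans (ler_normB _ _))// (splitr e) mulrDl lerD//.
  rewrite (le_trans (norm_mulmx_le _ _))// mulrAC.
  apply: (@le_trans _ _ (q * (c * `|z - x|))).
    rewrite ler_pM// ?mulr_ge0// ler_wpM2l//.
    rewrite -[Q z](subrK (Q x)) addrC (le_trans (ler_normD _ _))// lerD2l distrC.
    exact: ltW.
  rewrite mulrA ler_wpM2r// /c mulrCA ger_pMr ?divr_gt0//.
  by rewrite ler_pdivrMr ?mul1r ?lerDl// ltr_wpDl.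
rewrite (le_trans (norm_mulmx_le _ _))//.
apply: (@le_trans _ _ (n%:R * (k * `|z - x|) * e')).
  by rewrite ler_pM// ?mulr_ge0// ?ler_wpM2l// ltW.
rewrite mulrA mulrAC ler_wpM2r// /e' mulrCA ger_pMr ?divr_gt0//.
by rewrite ler_pdivrMr ?mul1r ?lerDl// ltr_wpDl// mulr_ge0// ltW.
Unshelve. all: by end_near. Qed.

(** * Maximizers of affine perturbations *)

Lemma near_dist_lt (R : realType) (a b : nat) (u : 'M[R]_(a, b)) (d : R) :
  0 < d -> \forall v \near u, `|v - u| < d.
Proof.
by move=> d0; apply/nbhs_normP; exists d => // v /=; rewrite distrC.
Qed.

Lemma dist_continuous (R : realType) (V : normedModType R) (u : V) :
  continuous (fun v => `|u - v|).
Proof.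
by move=> v; apply: cvg_norm; apply: cvgB; [exact: cvg_cst|exact: cvg_id].
Qed.

(** * Entrywise inner product and compactness of sets of matrices *)

Section Dotmx.
Variables (R : realType) (a b : nat).
Implicit Types x y z : 'M[R]_(a, b).

Lemma dotmx_is_linear x : linear (dotmx x : _ -> R).
Proof.
move=> k y z; rewrite /dotmx scaler_sumr -big_split/=; apply: eq_bigr => i _.
rewrite scaler_sumr -big_split/=; apply: eq_bigr => j _.
by rewrite !mxE mulrDr /GRing.scale/= mulrCA.
Qed.

Definition dotmx_linear x : 'M[R]_(a, b) -> R := dotmx x.

HB.instance Definition _ x := GRing.isLinear.Build R 'M[R]_(a, b) R *:%R
  (dotmx_linear x) (dotmx_is_linear x).

Lemma continuous_dotmx x : continuous (dotmx x).
Proof. exact: (@linear_mx_continuous R a b R (dotmx_linear x)). Qed.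

Lemma dotmxC x y : dotmx x y = dotmx y x.
Proof. by apply: eq_bigr => i _; apply: eq_bigr => j _; rewrite mulrC. Qed.

Lemma dotmxDr x y z : dotmx x (y + z) = dotmx x y + dotmx x z.
Proof. exact: (linearD (dotmx_linear x)). Qed.

Lemma dotmxBr x y z : dotmx x (y - z) = dotmx x y - dotmx x z.
Proof. exact: (linearB (dotmx_linear x)). Qed.

Lemma dotmxBl x y z : dotmx (x - y) z = dotmx x z - dotmx y z.
Proof. by rewrite dotmxC dotmxBr !(dotmxC z). Qed.

Lemma dotmxZr k x y : dotmx x (k *: y) = k * dotmx x y.
Proof. by rewrite -[LHS]/(dotmx_linear x (k *: y)) linearZ. Qed.

Lemma dotmx_delta x i j : dotmx x (delta_mx i j) = x i j.
Proof.
rewrite /dotmx (bigD1 i)//= (bigD1 j)//= mxE !eqxx mulr1 !big1 ?addr0//.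
  by move=> k ki; rewrite big1// => l _; rewrite mxE (negbTE ki) mulr0.
by move=> l lj; rewrite mxE eqxx (negbTE lj) mulr0.
Qed.

Lemma norm_dotmx_le x y : `|dotmx x y| <= (a * b)%:R * `|x| * `|y|.
Proof.
rewrite (le_trans (ler_norm_sum _ _ _))//.
apply: (@le_trans _ _ (\sum_(i < a) \sum_(j < b) `|x| * `|y|)).
  apply: ler_sum => i _; rewrite (le_trans (ler_norm_sum _ _ _))//.
  by apply: ler_sum => j _; rewrite normrM ler_pM// le_coord_norm.
by rewrite !sumr_const !card_ord -mulrnA -[leLHS]mulr_natl mulrA mulnC.
Qed.

(** Heine-Borel for row vectors, transported along the continuous reshaping [vec_mx]. *)
Lemma compact_mx (K : set 'M[R]_(a, b)) : bounded_set K -> closed K -> compact K.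
Proof.
move=> [B [Br HB]] Kc.
have vc : continuous (vec_mx : 'rV[R]_(a * b) -> 'M[R]_(a, b)).
  exact: linear_mx_continuous.
have -> : K = vec_mx @` (vec_mx @^-1` K).
  by rewrite image_preimage// -subTset => x _; exists (mxvec x) => //; rewrite mxvecK.
apply: continuous_compact; first exact: continuous_subspaceT.
apply: bounded_closed_compact; last by apply: closed_comp => // v _; exact: vc.
exists B; split => // c Bc v /= /(HB c Bc) vle.
apply: norm_mx_le => [|i k]; first exact: le_trans vle.
case/mxvec_indexP: k => k l; have -> : v i (mxvec_index k l) = vec_mx v k l.
  by rewrite mxE ord1.
exact: le_trans (le_coord_norm _ _ _) _.
Qed.

End Dotmx.

(** Used twice: for the entropy, where [us] selects the maximizer, and for the dual potential, where
    [hatlam] does. *)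
Definition maximizer (R : realType) (a b : nat) (A : 'M[R]_(a, b) -> R)
    (u l : 'M[R]_(a, b)) : Prop :=
  forall l', dotmx l' u - A l' <= dotmx l u - A l.

(* The value at u of the convex conjugate of A when L u maximizes l.u - A(l). *)
Definition conjugate (R : realType) (a b : nat) (A : 'M[R]_(a, b) -> R)
    (L : 'M[R]_(a, b) -> 'M[R]_(a, b)) (u : 'M[R]_(a, b)) : R :=
  dotmx (L u) u - A (L u).

Section Conjugate.
Variables (R : realType) (a b : nat) (A : 'M[R]_(a, b) -> R).
Variable (L : 'M[R]_(a, b) -> 'M[R]_(a, b)).
Implicit Types u v l : 'M[R]_(a, b).

(* L v competes with the maximizers at the finitely many points u +- (d/2) e_ij,
   which bounds each of its entries. *)
Lemma maximizer_bounded u :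
  (\forall v \near u, maximizer A v (L v)) ->
  exists2 B, 0 < B & \forall v \near u, `|L v| <= B.
Proof.
move=> Hmax; have /nbhs_normP[d /= d0 Hd] := Hmax.
have d20 : 0 < d / 2 by rewrite divr_gt0.
pose e (ij : 'I_a * 'I_b) : 'M[R]_(a, b) := (d / 2) *: delta_mx ij.1 ij.2.
have Hp v : `|v| <= d / 2 -> maximizer A (u + v) (L (u + v)).
  move=> vd; apply: Hd; rewrite /= opprD addNKr normrN (le_lt_trans vd)//.
  by rewrite ltr_pdivrMr// ltr_pMr// ltr1n.
have He ij : `|e ij| <= d / 2.
  rewrite /e normrZ gtr0_norm// ler_piMr ?(ltW d20)//.
  by apply: norm_mx_le => // i j; rewrite mxE; case: andP; rewrite ?normr1 ?normr0.
pose N : R := (a * b)%:R.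
have N0 : 0 <= N by [].
pose c ij := `|conjugate A L (u + e ij)| + `|conjugate A L (u - e ij)|.
pose m := \big[Num.max/0]_ij c ij.
have m0 : 0 <= m by apply: bigmax_ge_id.
pose C := m + `|conjugate A L u| + N * `|L u|.
have C0 : 0 <= C by rewrite !addr_ge0// mulr_ge0.
(* The estimate reached at the end is [|L v| <= (C + d / 4 * |L v|) / (d / 2)]. Half of [|L v|] is
   absorbed on the left, leaving [4 * C / d]; the [+ 1] keeps the bound positive. *)
exists (4 * (C + 1) / d).
  by rewrite divr_gt0// mulr_gt0// ltr_wpDl.
near=> v.
have vd : `|v - u| < d / 4 / (N + 1).
  near: v; apply: near_dist_lt; by rewrite divr_gt0 ?ltr_wpDl// divr_gt0.
have v1 : `|v - u| < 1.
  by near: v; apply: near_dist_lt.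
have Hv : maximizer A v (L v) by near: v.
have Nv : N * `|v - u| <= d / 4.
  rewrite (le_trans (ler_wpM2l N0 (ltW vd)))// mulrC mulrAC ler_pdivrMr ?ltr_wpDl//.
  by rewrite ler_wpM2l ?lerDl// divr_ge0// ltW.
(* Adds two optimality statements: [L (u + w)] against [L v] at [u + w], and [L v] against [L u] at
   [v]. The terms [A (L v)] cancel and only pairings with [w] and [v - u] remain. *)
have key (w : 'M[R]_(a, b)) : `|w| <= d / 2 -> `|conjugate A L (u + w)| <= m ->
    dotmx (L v) w <= C + d / 4 * `|L v|.
  move=> wd cw.
  have H1 := Hp w wd (L v).
  have H2 := Hv (L u).
  have H3 : dotmx (L v) (v - u) <= d / 4 * `|L v|.
    rewrite (le_trans (ler_norm _))// (le_trans (norm_dotmx_le _ _))//.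
    by rewrite mulrAC ler_wpM2r.
  have H4 : - (N * `|L u|) <= dotmx (L u) (v - u).
    rewrite lerNl (le_trans (ler_norm _))// normrN (le_trans (norm_dotmx_le _ _))//.
    by rewrite ler_piMr// ?mulr_ge0// ltW.
  rewrite -/(conjugate A L (u + w)) in H1.
  have H5 : conjugate A L (u + w) <= m by rewrite (le_trans (ler_norm _)).
  have H6 : - `|conjugate A L u| <= conjugate A L u.
    by rewrite lerNl (le_trans (ler_norm _))// normrN.
  rewrite /C; move: H1 H2 H3 H4 H5 H6; rewrite /conjugate !dotmxBr !dotmxDr; lra.
have key2 i j : `|L v i j| <= (C + d / 4 * `|L v|) / (d / 2).
  have cm : c (i, j) <= m by exact: (le_bigmax _ c (i, j)).
  rewrite ler_pdivlMr// -[X in _ * X <= _](gtr0_norm d20) -normrM ler_norml.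
  have E : dotmx (L v) (e (i, j)) = L v i j * (d / 2).
    by rewrite dotmxZr dotmx_delta mulrC.
  apply/andP; split.
    rewrite lerNl -E -(linearN (dotmx_linear _)) key ?normrN//.
    by rewrite (le_trans _ cm)// lerDr.
  by rewrite -E key// (le_trans _ cm)// lerDl.
have : `|L v| <= (C + d / 4 * `|L v|) / (d / 2).
  apply: norm_mx_le => //; apply: divr_ge0; last exact: ltW.
  by rewrite addr_ge0// mulr_ge0// divr_ge0// ltW.
rewrite !ler_pdivlMr// => H.
by lra.
Unshelve. all: by end_near. Qed.

(** Maximizers near [u] stay in a ball. On the part of the ball at distance at least [e] from [L u],
    compactness and uniqueness make the objective at [u] worse than its optimum by a fixed gap,
    which a small move from [u] to [v] cannot close. *)
Lemma maximizer_continuous u :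
  continuous A ->
  (\forall v \near u, maximizer A v (L v)) ->
  (forall l, maximizer A u l -> l = L u) ->
  L v @[v --> u] --> L u.
Proof.
move=> Ac Hmax Huniq; have [B B0 HB] := maximizer_bounded Hmax.
have Hu := nbhs_singleton Hmax.
apply/(@cvgrPdist_lt _ _ _ (nbhs u)) => e e0.
pose K := [set l | `|l| <= B] `&` [set l | e <= `|L u - l|].
pose g l := A l - dotmx l u.
have Kco : compact K.
  apply: compact_mx.
    exists B; split=> [|c Bc l [/= lB _]]; first exact: num_real.
    by rewrite (le_trans lB)// ltW.
  apply: closedI.
    apply: (@closed_comp _ _ (fun l => `|l|) [set x | x <= B]) => [l _|].
      exact: norm_continuous.
    exact: closed_le.
  apply: (@closed_comp _ _ (fun l => `|L u - l|) [set x | e <= x]) => [l _|].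
    exact: (@dist_continuous _ 'M[R]_(a, b)).
  exact: closed_ge.
(* The extreme value theorem requires a nonempty set; if [K] is empty, [L v] has no room to be far
   from [L u]. *)
have [K0|/set0P K0] := eqVneq K set0.
  near=> v; rewrite ltNge; apply/negP => ev.
  suff : K (L v) by rewrite K0.
  by split => //=; near: v.
have gc : {within K, continuous g}.
  have -> : g = fun l => A l - dotmx u l by apply/funext => l; rewrite /g dotmxC.
  apply: continuous_subspaceT => l.
  apply: (@cvgB _ _ _ (nbhs l) _ A (dotmx u)); first exact: Ac.
  exact: continuous_dotmx.
have [k /[!inE] Kk Hk] := compact_EVT_min K0 Kco gc.
have gk : g (L u) < g k.
  rewrite ltNge; apply/negP => gkL.
  have kL : k = L u.
    by apply: Huniq => l; have := Hu l; move: gkL; rewrite /g; lra.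
  by case: Kk => _ /=; rewrite kL subrr normr0 leNgt e0.
(* [c] dominates the factor of [|v - u|] in the bound on [dotmx (L v - L u) (v - u)]; the [+ 1]
   makes it positive for the division. *)
pose c : R := (a * b)%:R * (B + `|L u|) + 1.
have c0 : 0 < c by rewrite ltr_wpDl// mulr_ge0// addr_ge0// ltW.
near=> v; rewrite ltNge; apply/negP => ev.
have LB : `|L v| <= B by near: v.
have Hv : maximizer A v (L v) by near: v.
have vu : `|v - u| < (g k - g (L u)) / c.
  near: v; apply: near_dist_lt; by rewrite divr_gt0// subr_gt0.
have H1 : g k <= g (L v) by apply: Hk; rewrite inE.
have H2 : dotmx (L v - L u) (v - u) < g k - g (L u).
  rewrite (le_lt_trans (ler_norm _))// (le_lt_trans (norm_dotmx_le _ _))//.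
  apply: (@le_lt_trans _ _ (c * `|v - u|)); last by rewrite mulrC -ltr_pdivlMr.
  rewrite ler_wpM2r// /c ler_wpDr// ler_wpM2l// (le_trans (ler_normB _ _))//.
  by rewrite lerD2r.
have := Hv (L u); move: H1 H2; rewrite dotmxBl !dotmxBr /g; lra.
Unshelve. all: by end_near. Qed.

Lemma conj_subgradient v w :
  maximizer A w (L w) -> conjugate A L v + dotmx (L v) (w - v) <= conjugate A L w.
Proof. by move=> /(_ (L v)); rewrite /conjugate dotmxBr; lra. Qed.

(** The subgradient inequalities at [v] and at [w] squeeze the first-order remainder between [0] and
    [dotmx (L w - L v) (w - v)], which is small against [|w - v|] by continuity of [L]. *)
Lemma is_diff_conj v :
  (forall w, maximizer A w (L w)) -> L w @[w --> v] --> L v ->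
  is_diff v (conjugate A L) (dotmx (L v)).
Proof.
move=> H Lc; apply: (@is_diff_le _ _ _ _ (dotmx_linear (L v))).
  exact: linear_mx_continuous.
move=> e e0; pose N : R := (a * b)%:R; have N0 : 0 <= N by [].
move/cvgrPdist_lt : Lc => Lc.
near=> w; rewrite -[X in _ - X]/(dotmx (L v) (w - v)).
have Lw : `|L v - L w| < e / (N + 1).
  by near: w; apply: Lc; rewrite divr_gt0// ltr_wpDl.
have H1 := conj_subgradient v (H w).
have H2 := conj_subgradient w (H v).
have H3 : dotmx (L w - L v) (w - v) <= e * `|w - v|.
  rewrite (le_trans (ler_norm _))// (le_trans (norm_dotmx_le _ _))// ler_wpM2r//.
  rewrite distrC (le_trans (ler_wpM2l N0 (ltW Lw)))// mulrCA ler_piMr// ?(ltW e0)//.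
  by rewrite ler_pdivrMr ?mul1r ?lerDl// ltr_wpDl.
have H4 : 0 <= conjugate A L w - conjugate A L v - dotmx (L v) (w - v) by lra.
rewrite ger0_norm//; move: H2 H3; rewrite dotmxBl !dotmxBr; lra.
Unshelve. all: by end_near. Qed.

End Conjugate.

(** * Legendre transform of the entropy *)

Lemma is_diff_dir_ge (R : realType) (V : normedModType R) (f df : V -> R) (x w : V)
    (c : R) :
  is_diff x f df ->
  (forall t : R, 0 < t -> t < 1 -> f x + t * c <= f (x + t *: w)) -> c <= df w.
Proof.
move=> dfx H; have [L Lc E] := is_diff_linear dfx; rewrite {}E in dfx *.
apply/ler_addgt0Pl => e e0.
pose n := `|w| + 1; have n0 : 0 < n by rewrite ltr_wpDl.
have en : 0 < e / n by rewrite divr_gt0.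
have /nbhs_normP[d /= d0 Hd] := is_diff_nearP dfx en.
(* [1 / 2] keeps [t] below 1, and [d / 2 / n] keeps [t *: w] within the radius [d] where the
   differential approximates [f]. *)
pose t := Num.min (1 / 2) (d / 2 / n).
have t0 : 0 < t by rewrite lt_min !divr_gt0.
have t1 : t < 1 by rewrite gt_min ltr_pdivrMr// mul1r ltr1n.
have tw : t * `|w| < d.
  have tn : t * n <= d / 2 by rewrite -ler_pdivlMr// ge_min lexx orbT.
  have wn : t * `|w| <= t * n by rewrite ler_wpM2l ?(ltW t0)// lerDl.
  by lra.
have := Hd (x + t *: w).
rewrite /= opprD addNKr normrN normrZ gtr0_norm// => /(_ tw).
have -> : x + t *: w - x = t *: w by rewrite addrC addKr.
rewrite normrZ gtr0_norm// => H1.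
have H2 := H t t0 t1.
have H3 : L (t *: w) = t * L w by rewrite linearZ.
rewrite H3 in H1.
have H4 := le_trans (ler_norm _) H1.
have H5 : e / n * `|w| <= e.
  by rewrite mulrAC ler_pdivrMr// ler_wpM2l ?(ltW e0)// lerDl.
have H6 : t * c <= t * (e + L w).
  have : e / n * (t * `|w|) <= t * e by rewrite mulrCA ler_wpM2l// ltW.
  rewrite mulrDr; lra.
by rewrite -(ler_pM2l t0).
Qed.

Lemma is_diff_grad (R : realType) (a b : nat) (h : 'M[R]_(a, b) -> R)
    (x g : 'M[R]_(a, b)) :
  is_diff x h (dotmx g) -> grad h x = g.
Proof.
move=> dh; apply/matrixP => i j; rewrite mxE deriveE; last by case: dh.
by case: dh => _ ->; exact: dotmx_delta.
Qed.

Lemma is_diff_dotmx_grad (R : realType) (a b : nat) (h : 'M[R]_(a, b) -> R)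
    (x : 'M[R]_(a, b)) :
  differentiable h x -> is_diff x h (dotmx (grad h x)).
Proof.
move=> dh; split => //; apply/funext => v.
rewrite {1}(matrix_sum_delta v) linear_sum; apply: eq_bigr => i _.
rewrite linear_sum; apply: eq_bigr => j _; rewrite linearZ mulrC /=.
by rewrite mxE deriveE.
Qed.

(** First-order optimality: maximality along the ray in direction [w] bounds [dotmx u w] by
    [dotmx g w], and the direction [- w] gives the reverse inequality. *)
Lemma maximizer_grad (R : realType) (a b : nat) (A : 'M[R]_(a, b) -> R)
    (u l g : 'M[R]_(a, b)) :
  is_diff l A (dotmx g) -> maximizer A u l -> g = u.
Proof.
move=> dA H; have key w : dotmx u w <= dotmx g w.
  apply: (is_diff_dir_ge dA) => t _ _; have := H (l + t *: w).
  rewrite [dotmx (l + _) _]dotmxC dotmxDr dotmxZr (dotmxC u l).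
  by rewrite -addrA lerD2l lerBlDr [- _ + _]addrC -lerBrDl.
have key2 w : dotmx g w = dotmx u w.
  apply/eqP; rewrite eq_le key andbT.
  have := key (0 - w); by rewrite sub0r -!(scaleN1r w) !dotmxZr !mulN1r lerN2.
by apply/matrixP => i j; rewrite -!dotmx_delta key2.
Qed.

(** Convexity bounds the chord slopes from [x] towards [y], and the bound passes to the derivative.
    As [is_diff_dir_ge] takes lower bounds, it is applied to [- s]. *)
Lemma strictly_convex_ge_tangent (R : realType) (a : nat) (s : 'cV[R]_a -> R) x y :
  strictly_convex s -> differentiable s x ->
  s x + dotmx (grad s x) (y - x) <= s y.
Proof.
move=> sconv ds; have [->|/eqP yx] := eqVneq y x.
  by rewrite dotmxBr; lra.
have dNs := is_diffN (is_diff_dotmx_grad ds).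
have : s x - s y <= - dotmx (grad s x) (y - x).
  apply: (is_diff_dir_ge dNs) => t t0 t1.
  have := sconv y x t yx t0 t1.
  have -> : t *: y + (1 - t) *: x = x + t *: (y - x).
    by rewrite scalerBl scale1r scalerBr addrCA.
  move=> H; rewrite -[(- s) _]/(- s _) -[(- s) (x + _)]/(- s (x + t *: (y - x))).
  move: H; move: (s (x + _)) (s x) (s y) => a1 a2 a3; clear -t0.
  rewrite mulrBr mulrBl mul1r. lra.
move: (s x) (s y) (dotmx _ _) => a1 a2 a3; clear; lra.
Qed.

Lemma maximizer_grad_convex (R : realType) (a : nat) (s : 'cV[R]_a -> R) x :
  strictly_convex s -> differentiable s x -> maximizer s (grad s x) x.
Proof.
move=> sconv ds l; have := strictly_convex_ge_tangent l sconv ds.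
rewrite dotmxBr !(dotmxC (grad s x)).
move: (s _) (s l) (dotmx _ _) (dotmx l _) => a1 a2 a3 a4; clear; lra.
Qed.

Section Legendre.
Variables (R : realType) (m p M Q : nat) (D : ipm R m p M Q).
Local Notation s := (ipm_entropy D).
Hypothesis sconv : strictly_convex s.
Hypothesis sdiff : forall u, differentiable s u.
Hypothesis gbij : bijective (grad s).

Lemma grad_us v : grad s (us D v) = v.
Proof.
case: gbij => g _ gK; rewrite /us pinvK// inE /=.
by exists (g v).
Qed.

Lemma us_maximizer v : maximizer s v (us D v).
Proof.
by rewrite -[v in maximizer s v](grad_us v); exact: maximizer_grad_convex.
Qed.

(** Any maximizer at [v] has gradient [v], so injectivity of [grad s] supplies the uniqueness on
    which continuity of maximizers rests. *)
Lemma us_continuous : continuous (us D).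
Proof.
move=> v; apply: maximizer_continuous.
- by move=> u; apply: differentiable_continuous; exact: sdiff.
- by near=> w; exact: us_maximizer.
- move=> l Hl; have gl := maximizer_grad (is_diff_dotmx_grad (sdiff l)) Hl.
  by apply: (bij_inj gbij); rewrite gl grad_us.
Unshelve. all: by end_near. Qed.

Lemma legendre_us : legendre s = conjugate s (us D).
Proof.
apply/funext => v; apply/le_anti/andP; split.
  apply: ge_sup; first by exists (dotmx v 0 - s 0); exists 0.
  by move=> _ [u _ <-]; rewrite dotmxC; exact: us_maximizer.
apply: ub_le_sup; last by exists (us D v) => //; rewrite dotmxC.
exists (conjugate s (us D) v) => _ [u _ <-]; rewrite dotmxC; exact: us_maximizer.
Qed.

Lemma is_diff_legendre v : is_diff v (legendre s) (dotmx (us D v)).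
Proof.
by rewrite legendre_us; apply: is_diff_conj; [exact: us_maximizer|exact: us_continuous].
Qed.

End Legendre.

Lemma is_diff_sum (R : realType) (V W : normedModType R) (I : Type) (r : seq I)
    (f df : I -> V -> W) (x : V) :
  (forall i, is_diff x (f i) (df i)) ->
  is_diff x (fun y => \sum_(i <- r) f i y) (fun h => \sum_(i <- r) df i h).
Proof.
move=> H; elim: r => [|i r IH].
  under eq_fun do rewrite big_nil; under [X in is_diff _ _ X]eq_fun do rewrite big_nil.
  exact: is_diff_cst.
under eq_fun do rewrite big_cons; under [X in is_diff _ _ X]eq_fun do rewrite big_cons.
exact: is_diffD.
Qed.

(** * Dual gradient and Hessian *)

Lemma is_diff_add_linear (R : realType) (V W : normedModType R) (f df : V -> W)
  (x : V) (c : W) : is_diff x f df -> is_diff x (fun y => f y + c) df.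
Proof.
move=> dfx; have := is_diffD dfx (is_diff_cst c x).
by rewrite addr0.
Qed.

(** Rests on the resolvent identity [H^-1 - K^-1 = - K^-1 (H - K) H^-1] together with a bound on
    [K^-1] uniform near [H]. *)
Lemma invmx_continuous (R : realType) (n : nat) (H : 'M[R]_n) :
  H \in unitmx -> invmx K @[K --> H] --> invmx H.
Proof.
move=> Hu; pose a := `|invmx H|; pose N : R := n%:R.
have N0 : 0 <= N by [].
have a0 : 0 <= a := normr_ge0 _.
pose q := N ^+ 2 * a + 1.
have q0 : 0 < q by rewrite ltr_wpDl// mulr_ge0// ?exprn_ge0.
apply/(@cvgrPdist_lt _ _ _ (nbhs H)) => e e0.
near=> K.
have KH : `|K - H| < 1 / 2 / q.
  by near: K; apply: near_dist_lt; rewrite !divr_gt0.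
have KHe : `|K - H| < e / (2 * a * q + 1).
  near: K; apply: near_dist_lt; rewrite divr_gt0// ltr_wpDl// !mulr_ge0//.
  exact: ltW.
(* Used twice: a [v] with [v K = 0] satisfies [v (H - K) H^-1 = v], hence [|v| <= |v| / 2] and
   [v = 0]; and with [y = K^-1] it gives [|K^-1| <= 2 a]. *)
have half m (y : 'M[R]_(m, n)) : `|y *m (H - K) *m invmx H| <= `|y| / 2.
  rewrite (le_trans (norm_mulmx_le _ _))//.
  apply: (@le_trans _ _ (N * (N * `|y| * `|H - K|) * a)).
    by rewrite ler_wpM2r// ler_wpM2l// norm_mulmx_le.
  have -> : N * (N * `|y| * `|H - K|) * a = `|y| * (N ^+ 2 * a * `|H - K|).
    by clearbody N a; ring.
  rewrite ler_wpM2l// distrC.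
  have : q * `|K - H| <= 2^-1 by rewrite mulrC -ler_pdivlMr// -div1r ltW.
  by apply: le_trans; rewrite /q mulrDl mul1r lerDl.
have Ku : K \in unitmx.
  rewrite -row_free_unit; apply: inj_row_free => v vK.
  have := half _ v; rewrite mulmxBr vK subr0 mulmxK// => vh.
  apply/eqP; rewrite -normr_le0; lra.
have E : invmx H - invmx K = - (invmx K *m (H - K) *m invmx H).
  by rewrite mulmxBr mulVmx// mulmxBl mulmxK// mul1mx opprB.
have K2 : `|invmx K| <= 2 * a.
  have : `|invmx K| <= a + `|invmx H - invmx K|.
    by rewrite -[invmx K in leLHS](subKr (invmx H)) (le_trans (ler_normB _ _)).
  have := half _ (invmx K); rewrite E normrN; rewrite -/a; lra.
rewrite E normrN (le_lt_trans (norm_mulmx_le _ _))//.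
apply: (@le_lt_trans _ _ (N * (N * (2 * a) * `|H - K|) * a)).
  rewrite ler_wpM2r// ler_wpM2l// (le_trans (norm_mulmx_le _ _))//.
  by rewrite ler_wpM2r// ler_wpM2l.
apply: (@le_lt_trans _ _ ((2 * a * q + 1) * `|K - H|)).
  rewrite distrC /q.
  have -> : N * (N * (2 * a) * `|K - H|) * a = 2 * a * (N ^+ 2 * a) * `|K - H|.
    by clearbody N a; ring.
  rewrite ler_wpM2r// mulrDr mulr1 -addrA lerDl addr_ge0// mulr_ge0//.
by rewrite mulrC -ltr_pdivlMr// ltr_wpDl// !mulr_ge0// ltW.
Unshelve. all: by end_near. Qed.

(** * Moment map, dual potential and their derivatives *)

Section Ipm.
Variables (R : realType) (m p M Q : nat) (D : ipm R m p M Q).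
Local Notation N := 'C(M + p, p).
Local Notation moments := 'M[R]_(N, m).
Local Notation s := (ipm_entropy D).
Local Notation xi := (ipm_node D).

Lemma is_diff_quad (V W : normedModType R) (h dh : V -> 'cV[R]_p -> W) (z : V) :
  (forall k, is_diff z (h ^~ (xi k)) (dh ^~ (xi k))) ->
  is_diff z (fun y => quad D (h y)) (fun v => quad D (dh v)).
Proof.
move=> H; rewrite /quad.
apply: (@is_diff_sum _ _ _ _ _
  (fun k y => (ipm_weight D k * density D (xi k)) *: h y (xi k))
  (fun k y => (ipm_weight D k * density D (xi k)) *: dh y (xi k))) => k.
Qed.

(** The arguments are swapped so that a linear structure can be attached to the dependence on
    [lam]. *)
Definition dual_state_at x (lam : moments) := dual_state D lam x.

Lemma dual_state_at_is_linear x : linear (dual_state_at x).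
Proof.
by move=> k y z; rewrite /dual_state_at /dual_state linearP mulmxDl scalemxAl.
Qed.

HB.instance Definition _ x :=
  GRing.isLinear.Build R moments 'cV[R]_m *:%R (dual_state_at x)
    (dual_state_at_is_linear x).

Lemma is_diff_dual_state x lam :
  is_diff lam (dual_state D ^~ x) (dual_state D ^~ x).
Proof. exact: (is_diff_linear_mx (dual_state_at x)). Qed.

Definition moment_of (h : 'cV[R]_p -> 'cV[R]_m) : moments :=
  (quad D (fun x => h x *m (Defs.basis D x)^T))^T.

Definition primal (lam : moments) : moments :=
  moment_of (fun x => us D (dual_state D lam x)).

Definition dprimal (lam v : moments) : moments :=
  moment_of (fun x => 'd (us D) (dual_state D lam x) (dual_state D v x)).

Lemma is_diff_moment_of (V : normedModType R) (h dh : V -> 'cV[R]_p -> 'cV[R]_m) (z : V) :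
  (forall k, is_diff z (h ^~ (xi k)) (dh ^~ (xi k))) ->
  is_diff z (fun y => moment_of (h y)) (fun v => moment_of (dh v)).
Proof.
move=> H; rewrite /moment_of.
apply: (is_diff_comp _ (is_diff_linear_mx trmx _)).
apply: is_diff_quad => k.
exact: (is_diff_comp (H k) (is_diff_linear_mx (mulmxr _) _)).
Qed.

Lemma is_diff_primal lam :
  (forall k, differentiable (us D) (dual_state D lam (xi k))) ->
  is_diff lam primal (dprimal lam).
Proof.
move=> H; apply: is_diff_moment_of => k.
apply: (is_diff_comp (is_diff_dual_state _ _)).
exact: differentiableP.
Qed.

Lemma dotmx_mul_tr (a b : nat) (y : 'cV[R]_b) (w : 'cV[R]_a) (v : 'M[R]_(a, b)) :
  dotmx (y *m w^T)^T v = dotmx y (v^T *m w).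
Proof.
rewrite /dotmx exchange_big/=; apply: eq_bigr => i _.
rewrite big_ord1 mxE mulr_sumr; apply: eq_bigr => j _.
by rewrite !mxE big_ord1 !mxE mulrA mulrAC.
Qed.

(** Brings the pairing with [primal lam] into the form that the chain rule gives for the derivative
    of [dual_potential]. *)
Lemma dotmx_primal lam v : dotmx (primal lam) v =
  quad D (fun x => dotmx (us D (dual_state D lam x)) (dual_state D v x) : R^o).
Proof.
rewrite /primal /moment_of {1}/quad linear_sum /= dotmxC.
rewrite -[LHS]/(dotmx_linear v _) linear_sum; apply: eq_bigr => k _.
rewrite !linearZ /=; congr (_ *: _).
by rewrite -dotmx_mul_tr dotmxC.
Qed.

Section Entropy.
Hypothesis sconv : strictly_convex s.
Hypothesis sdiff : forall u, differentiable s u.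
Hypothesis gbij : bijective (grad s).

Definition dual_potential (lam : moments) : R :=
  quad D (fun x => legendre s (dual_state D lam x) : R^o).

(** A sign change places [hatlam] within the theory of maximizers of affine perturbations. *)
Lemma dual_minimizerE u lam :
  dual_minimizer D u lam <-> maximizer dual_potential u lam.
Proof.
split=> H l; have := H l; rewrite /dual_obj -!/(dual_potential _).
  by rewrite -lerN2 !opprB.
by rewrite -[in X in _ -> X]lerN2 !opprB.
Qed.

Lemma is_diff_dual_potential lam :
  is_diff lam dual_potential (dotmx (primal lam)).
Proof.
rewrite (_ : dotmx (primal lam) = fun v => quad D
  (fun x => dotmx (us D (dual_state D lam x)) (dual_state D v x) : R^o)).
  apply: (@is_diff_quad _ R) => k.
  exact: (is_diff_comp (is_diff_dual_state _ _) (is_diff_legendre sconv sdiff gbij _)).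
by apply/funext => v; exact: dotmx_primal.
Qed.

Lemma dual_gradE lam u : dual_grad D lam u = primal lam - u.
Proof.
apply: is_diff_grad.
rewrite (_ : dotmx _ = dotmx (primal lam) - dotmx u); last first.
  by apply/funext => v; exact: dotmxBl.
rewrite (_ : (fun l => _) = dual_potential - dotmx u); last first.
  by apply/funext => l; rewrite /dual_obj dotmxC.
apply: is_diffB; first exact: is_diff_dual_potential.
exact: (is_diff_linear_mx (dotmx_linear u)).
Qed.

(** The formula for the dual gradient holds at every point, so it can be differentiated: the Hessian
    is the matrix of the derivative of [primal]. *)
Lemma dual_hessE lam u dF v : is_diff lam primal dF ->
  mxvec v *m dual_hess D lam u = mxvec (dF v).
Proof.
move=> dP; rewrite /dual_hess /hess /jacobian mul_rV_lin1.
rewrite (_ : (fun _ => _) = mxvec \o ((fun l => primal l - u) \o vec_mx)); last first.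
  by apply/funext => x /=; rewrite -[grad _ _]/(dual_grad D _ u) dual_gradE.
have dP' : is_diff (vec_mx (mxvec lam)) (fun l => primal l - u) dF.
  by rewrite mxvecK; exact: is_diff_add_linear.
have := is_diff_comp (is_diff_comp (is_diff_linear_mx vec_mx _) dP')
  (is_diff_linear_mx mxvec _).
by case=> _ /= ->; rewrite /= mxvecK.
Qed.

End Entropy.
End Ipm.

(** * Differentials of the exact and Newton dual updates *)

Lemma cvg_mx (R : realType) (T : Type) (F : set_system T) (FF : Filter F) (a b : nat)
    (f : T -> 'M[R]_(a, b)) (A : 'M[R]_(a, b)) :
  (forall i j, f z i j @[z --> F] --> A i j) -> f z @[z --> F] --> A.
Proof.
move=> H; apply/cvgrPdist_le => e e0; near=> z.
apply: norm_mx_le => [|i j]; first exact: ltW.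
rewrite !mxE; move: i j; near: z; apply: filter_forall => i; apply: filter_forall => j.
by have /cvgrPdist_le := H i j; apply.
Unshelve. all: by end_near. Qed.

Lemma cvg_linear_mx (R : realType) (T : Type) (F : set_system T) (FF : Filter F)
    (a b : nat) (W : normedModType R) (L : {linear 'M[R]_(a, b) -> W})
    (f : T -> 'M[R]_(a, b)) A :
  f z @[z --> F] --> A -> L (f z) @[z --> F] --> L A.
Proof. by move=> fA; apply: (cvg_comp _ _ fA); exact: linear_mx_continuous. Qed.

Lemma is_diff_fst (R : realType) (V W : normedModType R) (z : V * W) :
  is_diff z (fst : V * W -> V) fst.
Proof.
apply: (@is_diff_le _ _ _ fst fst).
  by move=> y; exact: cvg_fst.
by move=> e e0; near=> y; rewrite /= subrr normr0 mulr_ge0// ltW.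
Unshelve. all: by end_near. Qed.

Lemma is_diff_snd (R : realType) (V W : normedModType R) (z : V * W) :
  is_diff z (snd : V * W -> W) snd.
Proof.
apply: (@is_diff_le _ _ _ snd snd).
  by move=> y; exact: cvg_snd.
by move=> e e0; near=> y; rewrite /= subrr normr0 mulr_ge0// ltW.
Unshelve. all: by end_near. Qed.

Section Ipm.
Variables (R : realType) (m p M Q : nat) (D : ipm R m p M Q).
Local Notation N := 'C(M + p, p).
Local Notation moments := 'M[R]_(N, m).
Local Notation s := (ipm_entropy D).
Local Notation xi := (ipm_node D).
Hypothesis sconv : strictly_convex s.
Hypothesis sdiff : forall u, differentiable s u.
Hypothesis gbij : bijective (grad s).

Lemma cvg_moment_of (T : Type) (F : set_system T) (FF : Filter F)
    (h : T -> 'cV[R]_p -> 'cV[R]_m) (h0 : 'cV[R]_p -> 'cV[R]_m) :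
  (forall k, h z (xi k) @[z --> F] --> h0 (xi k)) ->
  moment_of D (h z) @[z --> F] --> moment_of D h0.
Proof.
move=> H; apply: (@cvg_linear_mx _ _ _ _ _ _ _ trmx).
apply: cvg_sumr => k; apply: cvgZl_tmp.
exact: (@cvg_linear_mx _ _ _ _ _ _ _ (mulmxr _)).
Qed.

Section At.
Variable lam : moments.
Hypothesis us_C1 : forall k, C1_near (us D) (dual_state D lam (xi k)).

Lemma near_is_diff_primal :
  \forall l \near lam, is_diff l (primal D) (dprimal D l).
Proof.
near=> l; apply: is_diff_primal; near: l; apply: filter_forall => k.
have c : dual_state D l (xi k) @[l --> lam] --> dual_state D lam (xi k).
  exact: (is_diff_continuous (is_diff_dual_state D (xi k) lam)).
apply: (c (fun y => differentiable (us D) y)).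
by apply: filterS (us_C1 k) => y [].
Unshelve. all: by end_near. Qed.

Lemma dprimal_cvg v : dprimal D l v @[l --> lam] --> dprimal D lam v.
Proof.
apply: (@cvg_moment_of _ (nbhs lam)) => k.
rewrite /dprimal.
have [_ /(_ (dual_state D v (xi k))) c1] := nbhs_singleton (us_C1 k).
exact: (@cvg_comp _ _ _ (fun l => dual_state D l (xi k))
  (fun y => 'd (us D) y (dual_state D v (xi k))) _ _ _
  (is_diff_continuous (is_diff_dual_state D (xi k) lam)) c1).
Qed.

Lemma dual_hess_cvg u :
  dual_hess D z.1 z.2 @[z --> (lam, u)] --> dual_hess D lam u.
Proof.
have E l v i j : is_diff l (primal D) (dprimal D l) ->
    dual_hess D l v i j = mxvec (dprimal D l (vec_mx (delta_mx 0 i))) 0 j.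
  move=> dl; rewrite -(dual_hessE sconv sdiff gbij v _ dl) vec_mxK -rowE.
  by rewrite [RHS]mxE.
move: (dual_hess D) E => H E; apply: cvg_mx => i j.
have -> : H lam u i j = mxvec (dprimal D lam (vec_mx (delta_mx 0 i))) 0 j.
  by apply: E; exact: nbhs_singleton near_is_diff_primal.
have c : mxvec (dprimal D z.1 (vec_mx (delta_mx 0 i))) 0 j @[z --> (lam, u)] -->
    mxvec (dprimal D lam (vec_mx (delta_mx 0 i))) 0 j.
  apply: (@cvg_comp _ _ _ (fun z => z.1)
    (fun l => mxvec (dprimal D l (vec_mx (delta_mx 0 i))) 0 j)).
    exact: cvg_fst.
  apply: (@cvg_comp _ _ _ (fun l => mxvec (dprimal D l (vec_mx (delta_mx 0 i))))
    (fun A : 'rV_(N * m) => A 0 j)).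
    by apply: cvg_linear_mx; exact: dprimal_cvg.
  exact: coord_continuous.
(* The entry formula [E] needs [primal] differentiable at [z.1], which holds only near [lam]. *)
apply: cvg_trans c; apply: near_eq_cvg; near=> z.
have dz : is_diff (z.1) (primal D) (dprimal D z.1).
  near: z.
  apply: (@cvg_fst _ _ (nbhs lam) (nbhs u) _
    (fun l => is_diff l (primal D) (dprimal D l))).
  exact: near_is_diff_primal.
by rewrite (E _ _ _ _ dz).
Unshelve. all: by end_near. Qed.

End At.

Section Point.
Variable u : moments.
Local Notation lam := (hatlam D u).
Hypothesis us_C1 : forall k, C1_near (us D) (dual_state D lam (xi k)).
Hypothesis lam_uniq : \forall v \near u, exists! l, dual_minimizer D v l.
Hypothesis Hunit : dual_hess D lam u \in unitmx.

(** The derivative of [hatlam] at [u] and also that of the Newton map in its moment argument; this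
    coincidence links the two iterations. *)
Definition newton_solve (w : moments) : moments :=
  vec_mx (mxvec w *m invmx (dual_hess D lam u)).

Lemma hatlam_maximizer v : (exists! l, dual_minimizer D v l) ->
  maximizer (dual_potential D) v (hatlam D v).
Proof.
move=> [l [Hl _]]; apply/dual_minimizerE.
by apply: (xgetPex 0); exists l.
Qed.

Lemma primal_hatlam v : (exists! l, dual_minimizer D v l) -> primal D (hatlam D v) = v.
Proof.
move=> /hatlam_maximizer Hv.
exact: maximizer_grad (is_diff_dual_potential sconv sdiff gbij _) Hv.
Qed.

Lemma hatlam_continuous : hatlam D v @[v --> u] --> lam.
Proof.
apply: (maximizer_continuous (A := dual_potential D)).
- by move=> l; apply: is_diff_continuous; exact: is_diff_dual_potential.
- by apply: filterS lam_uniq => v; exact: hatlam_maximizer.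
- have Hu := nbhs_singleton lam_uniq.
  move=> l /dual_minimizerE Hl; case: (Hu) => l' [_ E].
  rewrite -(E l)// -(E lam)//; apply/dual_minimizerE.
  exact: hatlam_maximizer.
Qed.

Lemma is_diff_hatlam : is_diff u (hatlam D) newton_solve.
Proof.
pose K : {linear moments -> moments} :=
  vec_mx \o (mulmxr (invmx (dual_hess D lam u)) \o mxvec).
have dP := nbhs_singleton (near_is_diff_primal us_C1).
apply: (@is_diff_right_inverse _ _ _ (primal D) (dprimal D lam) _ K).
- by apply: filterS lam_uniq => v; exact: primal_hatlam.
- exact: hatlam_continuous.
- exact: linear_mx_continuous.
- by move=> v; rewrite /K /= -(dual_hessE sconv sdiff gbij u _ dP) mulmxK// mxvecK.
Qed.

Lemma is_diff_newton :
  is_diff (lam, u) (fun z => newton D z.1 z.2) (fun h => newton_solve h.2).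
Proof.
have dP := nbhs_singleton (near_is_diff_primal us_C1).
have Pu : primal D lam = u by apply: primal_hatlam; exact: nbhs_singleton lam_uniq.
rewrite (_ : (fun z => newton _ _ _) = (fun z => z.1) - (vec_mx \o
    (fun z => mxvec (primal D z.1 - z.2) *m invmx (dual_hess D z.1 z.2)))); last first.
  apply/funext => z; rewrite /newton dual_gradE//.
have d1 : is_diff (lam, u) (fun z : moments * moments => z.1) (fun z => z.1).
  exact: is_diff_fst.
have d2 : is_diff (lam, u) (fun z : moments * moments => z.2) (fun z => z.2).
  exact: is_diff_snd.
have dy : is_diff (lam, u) (fun z => mxvec (primal D z.1 - z.2))
    (fun h => mxvec (dprimal D lam h.1 - h.2)).
  have H1 : is_diff (lam, u) (fun z => primal D z.1) (fun h => dprimal D lam h.1).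
    exact: (is_diff_comp d1 dP).
  exact: (is_diff_comp (is_diffB H1 d2) (is_diff_linear_mx mxvec _)).
have y0 : mxvec (primal D (lam, u).1 - (lam, u).2) = 0 by rewrite /= Pu subrr linear0.
have Qc : invmx (dual_hess D z.1 z.2) @[z --> (lam, u)] --> invmx (dual_hess D lam u).
  apply: (cvg_comp (fun z => dual_hess D z.1 z.2) invmx); first exact: dual_hess_cvg.
  exact: invmx_continuous.
have dprod := is_diff_mulmx_vanishing dy y0 Qc.
apply: (is_diff_eq (is_diffB d1 (is_diff_comp dprod (is_diff_linear_mx vec_mx _)))).
apply/funext => h.
rewrite -[LHS]/(h.1 -
  vec_mx (mxvec (dprimal D lam h.1 - h.2) *m invmx (dual_hess D lam u))).
(* The Hessian represents [dprimal D lam], so its inverse returns [h.1], which cancels the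
   derivative of the leading [lam] in the Newton map. *)
have -> : mxvec (dprimal D lam h.1 - h.2) *m invmx (dual_hess D lam u) =
    mxvec h.1 - mxvec h.2 *m invmx (dual_hess D lam u).
  have -> : mxvec (dprimal D lam h.1 - h.2) = mxvec (dprimal D lam h.1) - mxvec h.2.
    by rewrite linearB.
  by rewrite -(dual_hessE sconv sdiff gbij u _ dP) mulmxBl mulmxK.
have -> : vec_mx (mxvec h.1 - mxvec h.2 *m invmx (dual_hess D lam u)) =
    h.1 - newton_solve h.2 by rewrite linearB /= mxvecK.
by rewrite opprB addrC subrK.
Qed.

End Point.
End Ipm.

(** * Spectral radius and cell vectors *)

(** A left eigenvector [(a, b)] satisfies [b A = z a] and [b B = z b]. If [z] is nonzero, [b = 0]
    would force [a = 0], so [b] is an eigenvector of [B]. *)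
Lemma eigenvalue_block0 (F : fieldType) (n1 n2 : nat) (A : 'M[F]_(n2, n1))
    (B : 'M[F]_n2) (z : F) :
  eigenvalue (block_mx 0 0 A B) z -> z = 0 \/ eigenvalue B z.
Proof.
move=> /eigenvalueP[v vE v0].
have [->|z0] := eqVneq z 0; [by left|right].
rewrite -[v]hsubmxK mul_row_block !mulmx0 !add0r scale_row_mx in vE.
have [vA vB] := eq_row_mx vE.
apply/eigenvalueP; exists (rsubmx v) => //.
apply: contra_neq v0 => r0; rewrite -[v]hsubmxK r0.
have -> : lsubmx v = 0.
  by apply/eqP; rewrite -(inj_eq (scalerI z0)) -vA r0 mul0mx scaler0.
exact: row_mx0.
Qed.

(** The supremum dominates its elements only if the set is bounded above; the sum of the moduli of
    all roots of the characteristic polynomial is a bound. *)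
Lemma normc_eigenvalue_le_radius (R : realType) (n : nat) (A : 'M[R]_n) (z : R[i]) :
  eigenvalue (map_mx (real_complex R) A) z ->
  ComplexField.Normc.normc z <= spectral_radius A.
Proof.
move=> Az; apply: ub_le_sup; last by exists z.
have p0 : char_poly (map_mx (real_complex R) A) != 0.
  by rewrite monic_neq0// char_poly_monic.
have [rs E] := closed_field_poly_normal (char_poly (map_mx (real_complex R) A)).
exists (\sum_(r <- rs) ComplexField.Normc.normc r) => _ [y /= Ay <-].
have nc_ge0 (x : R[i]) : 0 <= ComplexField.Normc.normc x.
  by case: x => a b; exact: sqrtr_ge0.
have yrs : y \in rs.
  move: Ay; rewrite eigenvalue_root_char E rootZ ?lead_coef_eq0//.
  by rewrite root_prod_XsubC.
by rewrite (big_rem y yrs)/= lerDl sumr_ge0.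
Qed.

Lemma spectral_radius_lt (R : realType) (n1 n2 : nat) (A : 'M[R]_n1)
    (B : 'M[R]_n2) (c : R) :
  (forall z, eigenvalue (map_mx (real_complex R) A) z ->
     z = 0 \/ eigenvalue (map_mx (real_complex R) B) z) ->
  0 < c -> spectral_radius B < c -> spectral_radius A < c.
Proof.
move=> AB c0 Bc.
(* Without eigenvalues the radius is the default [sup set0 = 0], and [0 < c] concludes. *)
have [E|/set0P ne] := eqVneq [set ComplexField.Normc.normc z | z in
        [set z : R[i] | eigenvalue (map_mx (real_complex R) A) z]] set0.
  by rewrite /spectral_radius E sup0.
apply: (@le_lt_trans _ _ (Num.max 0 (spectral_radius B))).
  apply: ge_sup => // _ [z /= /AB[->|Bz] <-]; rewrite le_max.
    by rewrite ComplexField.Normc.normc0 lexx.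
  by rewrite normc_eigenvalue_le_radius ?orbT.
by rewrite gt_max c0.
Qed.

Lemma is_diff_mul_jacobian (R : realType) (n1 n2 : nat) (f df : 'rV[R]_n1 -> 'rV[R]_n2)
    (x h : 'rV[R]_n1) :
  is_diff x f df -> h *m jacobian f x = df h.
Proof. by case=> _ <-; rewrite mul_rV_lin1. Qed.

(** In [v *m jacobian f x] the first block of [v] meets the upper rows, which vanish because the
    derivative reads only [rsubmx v]. *)
Lemma jacobian_row_mx_rsub (R : realType) (n n1 n2 : nat)
    (f : 'rV[R]_(n1 + n) -> 'rV[R]_(n1 + n2)) (g dg : 'rV[R]_n -> 'rV[R]_n1)
    (h dh : 'rV[R]_n -> 'rV[R]_n2) x y :
  is_diff x f (fun v => row_mx (dg (rsubmx v)) (dh (rsubmx v))) ->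
  is_diff y g dg -> is_diff y h dh ->
  jacobian f x = block_mx 0 0 (jacobian g y) (jacobian h y).
Proof.
move=> df dgy dhy; apply/row_matrixP => i; rewrite !rowE.
set v : 'rV_(n1 + n) := delta_mx 0 i.
rewrite (is_diff_mul_jacobian v df) -[v in RHS]hsubmxK mul_row_block.
rewrite !mulmx0 !add0r.
by rewrite (is_diff_mul_jacobian _ dgy) (is_diff_mul_jacobian _ dhy).
Qed.

(** * Families of cell values as row vectors *)

Section Packing.
Variables (R : realType) (m p M Nx : nat).
Local Notation N := 'C(M + p, p).
Local Notation moments := 'M[R]_(N, m).

Lemma packK (v : 'I_Nx -> moments) : unpack (pack v) = v.
Proof.
apply/funext => j; rewrite /unpack /pack mxvecK.
rewrite (_ : row j _ = mxvec (v j)) ?mxvecK//.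
by apply/rowP => k; rewrite !mxE.
Qed.

Definition unpack_at (j : 'I_Nx) (x : 'rV[R]_(Nx * (N * m))) : moments := unpack x j.

Lemma unpack_at_is_linear j : linear (unpack_at j).
Proof. by move=> k x y; rewrite /unpack_at /unpack !linearP. Qed.

HB.instance Definition _ j := GRing.isLinear.Build R 'rV[R]_(Nx * (N * m)) moments *:%R
  (unpack_at j) (unpack_at_is_linear j).

Lemma is_diff_unpack x j : is_diff x (fun x : 'rV[R]_(Nx * (N * m)) => unpack x j)
  (fun x => unpack x j).
Proof. exact: (is_diff_linear_mx (unpack_at j)). Qed.

(** Splits [pack] into linear images of single cells, so that differentiability can be checked cell
    by cell. *)
Lemma pack_sum (v : 'I_Nx -> moments) :
  pack v = \sum_j (mxvec \o (mulmx (delta_mx j 0 : 'cV_Nx) \o mxvec)) (v j).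
Proof.
rewrite /pack /= -linear_sum; congr mxvec.
apply/matrixP => i k; rewrite mxE summxE (bigD1 i)//= big1 ?addr0 => [|j ji].
  by rewrite mxE big_ord1 mxE !eqxx mul1r.
by rewrite mxE big_ord1 mxE eq_sym (negbTE ji) mul0r.
Qed.

Lemma is_diff_pack (V : normedModType R) (f df : 'I_Nx -> V -> moments) (z : V) :
  (forall j, is_diff z (f j) (df j)) ->
  is_diff z (fun y => pack (fun j => f j y)) (fun h => pack (fun j => df j h)).
Proof.
move=> H; under eq_fun do rewrite pack_sum.
under [X in is_diff _ _ X]eq_fun do rewrite pack_sum.
apply: is_diff_sum => j.
exact: (is_diff_comp (H j) (is_diff_linear_mx _ _)).
Qed.

End Packing.

Lemma is_diff_row_mx (R : realType) (V : normedModType R) (a n1 n2 : nat)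
    (f df : V -> 'M[R]_(a, n1)) (g dg : V -> 'M[R]_(a, n2)) (z : V) :
  is_diff z f df -> is_diff z g dg ->
  is_diff z (fun y => row_mx (f y) (g y)) (fun h => row_mx (df h) (dg h)).
Proof.
move=> fz gz.
have rowE (A : 'M[R]_(a, n1)) (B : 'M[R]_(a, n2)) :
    row_mx A B = A *m row_mx 1%:M 0 + B *m row_mx 0 1%:M.
  by rewrite !mul_mx_row !mulmx1 !mulmx0 add_row_mx addr0 add0r.
under eq_fun do rewrite rowE; under [X in is_diff _ _ X]eq_fun do rewrite rowE.
by apply: is_diffD; apply: (is_diff_comp _ (is_diff_linear_mx (mulmxr _) _)).
Qed.

(** * Factorization of both iterations through the finite volume update *)

Section Cells.
Variables (R : realType) (m p M Nx Q : nat) (D : ipm R m p M Q).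
Local Notation N := 'C(M + p, p).
Local Notation moments := 'M[R]_(N, m).
Local Notation xi := (ipm_node D).

Lemma cstepE (ll lc lr : moments) : cstep D ll lc lr =
  moment_of D (fun x => us D (dual_state D lc x))
  - (ipm_dt D / ipm_dx D) *:
    (moment_of D (fun x => ipm_numflux D (us D (dual_state D lc x))
                                     (us D (dual_state D lr x)))
   - moment_of D (fun x => ipm_numflux D (us D (dual_state D ll x))
                                     (us D (dual_state D lc x)))).
Proof. by []. Qed.

Lemma differentiable_moment_of (V : normedModType R) (h : V -> 'cV[R]_p -> 'cV[R]_m) z :
  (forall k, differentiable (h ^~ (xi k)) z) ->
  differentiable (fun y => moment_of D (h y)) z.
Proof.
move=> H.
have [] // : is_diff z (fun y => moment_of D (h y))
  (fun v => moment_of D (fun x => 'd (h ^~ x) z v)).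
by apply: is_diff_moment_of => k; exact: differentiableP.
Qed.

Lemma differentiable_cstep (V : normedModType R) (ll lc lr : V -> moments) z :
  (forall k, differentiable (fun y => us D (dual_state D (ll y) (xi k))) z) ->
  (forall k, differentiable (fun y => us D (dual_state D (lc y) (xi k))) z) ->
  (forall k, differentiable (fun y => us D (dual_state D (lr y) (xi k))) z) ->
  (forall k, differentiable (fun w : 'cV[R]_m * 'cV[R]_m => ipm_numflux D w.1 w.2)
     (us D (dual_state D (ll z) (xi k)), us D (dual_state D (lc z) (xi k)))) ->
  (forall k, differentiable (fun w : 'cV[R]_m * 'cV[R]_m => ipm_numflux D w.1 w.2)
     (us D (dual_state D (lc z) (xi k)), us D (dual_state D (lr z) (xi k)))) ->
  differentiable (fun y => cstep D (ll y) (lc y) (lr y)) z.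
Proof.
move=> dl dc dr gl gr; under eq_fun do rewrite cstepE.
apply: differentiableB; first exact: differentiable_moment_of.
apply: differentiableZ; apply: differentiableB; apply: differentiable_moment_of => k.
- exact: (@differentiable_comp _ _ _ _ _ (fun w => ipm_numflux D w.1 w.2) _
    (differentiable_pair (dc k) (dr k)) (gr k)).
- exact: (@differentiable_comp _ _ _ _ _ (fun w => ipm_numflux D w.1 w.2) _
    (differentiable_pair (dl k) (dc k)) (gl k)).
Qed.

(** Here [a] and [b] are dual variables of the ghost cells. The classical step is this map after
    [hatlam], the moment part of the one-shot step is this map after Newton. *)
Definition cells_step (a b : moments) (x : 'rV[R]_(Nx * (N * m))) :
    'rV[R]_(Nx * (N * m)) :=
  let L := with_ghosts a b (unpack x) in
  pack (fun j : 'I_Nx => cstep D (L j) (L j.+1) (L j.+2)).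

Lemma differentiable_cells_step (a b : moments) (lam : 'I_Nx -> moments) :
  let Lam := with_ghosts a b lam in
  (forall j k, differentiable (us D) (dual_state D (lam j) (xi k))) ->
  (forall (j : 'I_Nx.+1) k,
     differentiable (fun z : 'cV[R]_m * 'cV[R]_m => ipm_numflux D z.1 z.2)
       (us D (dual_state D (Lam j) (xi k)), us D (dual_state D (Lam j.+1) (xi k)))) ->
  differentiable (cells_step a b) (pack lam).
Proof.
move=> Lam dus dg.
have dL (j : nat) k : differentiable
    (fun x => us D (dual_state D (with_ghosts a b (unpack x) j) (xi k))) (pack lam).
  case: j => [|j] /=; first exact: differentiable_cst.
  case: insubP => [i _ _|_]; last exact: differentiable_cst.
  apply: (@differentiable_comp _ _ _ _
    (fun x => dual_state D (unpack x i) (xi k)) (us D)).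
    have [] // := is_diff_comp (is_diff_unpack (pack lam) i)
      (is_diff_dual_state D (xi k) _).
  by rewrite packK.
rewrite /cells_step.
have [] // : is_diff (pack lam) (cells_step a b) (fun h => pack (fun j : 'I_Nx =>
    'd (fun x => let L := with_ghosts a b (unpack x) in
       cstep D (L j) (L j.+1) (L j.+2)) (pack lam) h)).
apply: is_diff_pack => j; apply: differentiableP.
apply: differentiable_cstep => k; try exact: dL; rewrite packK.
  (* The index [j : 'I_Nx] denotes cell [j.+1], whose left and right interfaces are numbered [j] and
     [j.+1] among the [Nx.+1] interfaces. *)
  have jN : (j < Nx.+1)%N by rewrite ltnW// ltnS.
  exact: (dg (Ordinal jN) k).
have jN : (j.+1 < Nx.+1)%N by rewrite ltnS.
exact: (dg (Ordinal jN) k).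
Qed.

Lemma hatlam_with_ghosts (a b : moments) (v : 'I_Nx -> moments) (j : nat) :
  hatlam D (with_ghosts a b v j) =
  with_ghosts (hatlam D a) (hatlam D b) (fun i => hatlam D (v i)) j.
Proof. by case: j => //= j; case: insub. Qed.

Lemma classical_mapE (a b : moments) (x : 'rV[R]_(Nx * (N * m))) :
  classical_map D a b x = cells_step (hatlam D a) (hatlam D b)
    (pack (fun j => hatlam D (unpack x j))).
Proof.
rewrite /classical_map /classical_step /cells_step /cstep_exact packK.
by congr pack; apply/funext => j; rewrite !hatlam_with_ghosts.
Qed.

Definition newton_map (x : 'rV[R]_(Nx * (N * m) + Nx * (N * m))) :
    'rV[R]_(Nx * (N * m)) :=
  pack (fun j => newton D (unpack (lsubmx x) j) (unpack (rsubmx x) j)).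

Lemma oneshot_mapE (a b : moments) x :
  oneshot_map D a b x =
  row_mx (newton_map x) (cells_step (hatlam D a) (hatlam D b) (newton_map x)).
Proof. by rewrite /oneshot_map /pack2 /= /cells_step packK. Qed.

End Cells.

Theorem theorem1 (R : realType) (m p M Nx Q : nat) (D : ipm R m p M Q)
    (f : 'cV[R]_m -> 'cV[R]_m)
    (d : measure_display) (T : measurableType d) (P : probability T R)
    (Theta : set 'cV[R]_p) (X : T -> 'cV[R]_p)
    (u0 u1 : 'M[R]_('C(M + p, p), m))
    (ustar : 'I_Nx -> 'M[R]_('C(M + p, p), m)) :
  let lamstar := fun j => hatlam D (ustar j) in
  let Lam := with_ghosts (hatlam D u0) (hatlam D u1) lamstar in
  let J := jacobian (oneshot_map D u0 u1) (pack2 lamstar ustar) in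
  (forall u, ipm_numflux D u u = f u) ->
  (forall t, Theta (X t)) ->
  has_product_density P X (ipm_density1 D) ->
  orthonormal_wrt P X (ipm_poly D) ->
  bijective (ipm_index D) ->
  (forall k, Theta (ipm_node D k)) ->
  0 < ipm_dt D -> 0 < ipm_dx D ->
  strictly_convex (ipm_entropy D) ->
  (forall u, differentiable (ipm_entropy D) u) ->
  bijective (grad (ipm_entropy D)) ->
  (* the exact dual variables are well defined where used *)
  (exists! lam, dual_minimizer D u0 lam) ->
  (exists! lam, dual_minimizer D u1 lam) ->
  (forall j, \forall v \near ustar j, exists! lam, dual_minimizer D v lam) ->
  (* regularity at the fixed point *)
  (forall (j : 'I_Nx) (k : 'I_Q),
     C1_near (us D) (dual_state D (lamstar j) (ipm_node D k))) ->
  (forall (j : 'I_Nx.+1) (k : 'I_Q),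
     C1_near (fun z : 'cV[R]_m * 'cV[R]_m => ipm_numflux D z.1 z.2)
       (us D (dual_state D (Lam j) (ipm_node D k)),
        us D (dual_state D (Lam j.+1) (ipm_node D k)))) ->
  (forall j, dual_hess D (lamstar j) (ustar j) \in unitmx) ->
  (* the classical iteration is contractive at its fixed point ustar *)
  (forall j, classical_step D u0 u1 ustar j = ustar j) ->
  spectral_radius (jacobian (classical_map D u0 u1 (Nx := Nx)) (pack ustar))
    < 1 ->
  [/\ oneshot_map D u0 u1 (pack2 lamstar ustar) = pack2 lamstar ustar,
      differentiable (oneshot_map D u0 u1) (pack2 lamstar ustar)
    & spectral_radius J < 1].
Proof.
move=> lamstar Lam J _ _ _ _ _ _ _ _ sconv sdiff gbij.
move=> Hu0 Hu1 Huniq us_C1 g_C1 Hunit fixed rho.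
pose n := (Nx * ('C(M + p, p) * m))%N.
pose K (h : 'rV[R]_n) : 'rV[R]_n :=
  pack (fun j => newton_solve D (ustar j) (unpack h j)).
pose G : 'rV[R]_n -> 'rV[R]_n := cells_step D (hatlam D u0) (hatlam D u1).
have dG : is_diff (pack lamstar) G ('d G (pack lamstar)).
  apply: differentiableP; apply: differentiable_cells_step => j k.
    by have [] := nbhs_singleton (us_C1 j k).
  by have [] := nbhs_singleton (g_C1 j k).
(* The dual gradient vanishes at the exact dual variables, so the Newton correction is zero. *)
have hatlam_newton j : newton D (lamstar j) (ustar j) = lamstar j.
  rewrite /newton dual_gradE// primal_hatlam//; last exact: nbhs_singleton (Huniq j).
  by rewrite subrr linear0 mul0mx linear0 subr0.
have newton_fixed : newton_map D (pack2 lamstar ustar) = pack lamstar.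
  rewrite /newton_map /pack2 row_mxKl row_mxKr !packK.
  by congr pack; apply/funext => j.
have dN : is_diff (pack2 lamstar ustar) (newton_map D) (K \o rsubmx).
  have dl j : is_diff (pack2 lamstar ustar) (fun x => unpack (lsubmx x) j)
      (fun x => unpack (lsubmx x) j).
    exact: (is_diff_comp (is_diff_linear_mx lsubmx _) (is_diff_unpack _ j)).
  have dr j : is_diff (pack2 lamstar ustar) (fun x => unpack (rsubmx x) j)
      (fun x => unpack (rsubmx x) j).
    exact: (is_diff_comp (is_diff_linear_mx rsubmx _) (is_diff_unpack _ j)).
  apply: is_diff_pack => j.
  have dn := is_diff_newton sconv sdiff gbij (us_C1 j) (Huniq j) (Hunit j).
  have E : (unpack (lsubmx (pack2 lamstar ustar)) j,
            unpack (rsubmx (pack2 lamstar ustar)) j)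
      = (lamstar j, ustar j) by rewrite /pack2 row_mxKl row_mxKr !packK.
  rewrite -[(hatlam _ _, _)]E in dn.
  exact: (is_diff_comp (is_diff_pair (dl j) (dr j)) dn).
pose hatlam_map (x : 'rV[R]_n) : 'rV[R]_n := pack (fun j => hatlam D (unpack x j)).
have dH : is_diff (pack ustar) hatlam_map K.
  apply: is_diff_pack => j.
  have dh := is_diff_hatlam sconv sdiff gbij (us_C1 j) (Huniq j) (Hunit j).
  have E : unpack (pack ustar) j = ustar j by rewrite packK.
  rewrite -[in X in is_diff X]E in dh.
  exact: (is_diff_comp (is_diff_unpack _ j) dh).
have dclass : is_diff (pack ustar) (classical_map D u0 u1 (Nx := Nx))
    ('d G (pack lamstar) \o K).
  rewrite (_ : classical_map _ _ _ = G \o hatlam_map).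
    by apply: (is_diff_comp dH); rewrite /hatlam_map packK.
  by apply/funext => x; exact: classical_mapE.
have oneE : oneshot_map D u0 u1 (Nx := Nx) =
    fun x => row_mx (newton_map D x) (G (newton_map D x)).
  by apply/funext => x; exact: oneshot_mapE.
have dG' : is_diff (newton_map D (pack2 lamstar ustar)) G ('d G (pack lamstar)).
  by rewrite newton_fixed.
(* The moment update uses the already updated dual variables, so its derivative is ['d G] after [K],
   the same composition as in [dclass]. *)
have doneshot : is_diff (pack2 lamstar ustar) (oneshot_map D u0 u1 (Nx := Nx))
    (fun h => row_mx (K (rsubmx h)) ('d G (pack lamstar) (K (rsubmx h)))).
  by rewrite oneE; apply: is_diff_row_mx.
split.
- rewrite oneE newton_fixed /pack2; congr row_mx.
  rewrite /G /cells_step packK; congr pack; apply/funext => j.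
  rewrite -[RHS]fixed /classical_step /cstep_exact.
  by rewrite !hatlam_with_ghosts.
- by case: doneshot.
- apply: (spectral_radius_lt _ ltr01 rho) => z.
  have JE : J = block_mx 0 0 (jacobian hatlam_map (pack ustar))
      (jacobian (classical_map D u0 u1 (Nx := Nx)) (pack ustar)).
    exact: jacobian_row_mx_rsub doneshot dH dclass.
  rewrite JE map_block_mx !map_mx0; exact: eigenvalue_block0.
Qed.
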